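(* Let $X$ be a complete geodesic metric space, let $x_0 \in X$, let $d>0$, and let $f\colon[0,\infty)\to[0,\infty)$ be nondecreasing. Suppose $X$ has $O(f)$ covering growth of dimension $d$ around $x_0$, i.e. $k\, r_{k^{d-1}}(\partial B_R(x_0)) \le f(R)$ for all $k\in\mathbb{N}$ and all $R>0$. Let $p\in[1,\infty)$ and $\delta>0$. Then there exists a constant $C>0$ such that for every finite Borel measure $\mu$ on $X$ with finite moments up to order $p+\delta$ (i.e. $\int_X d(x,x_0)^{p+\delta}\,d\mu(x)<\infty$; $C$ is independent of $\mu$), $$k^p\, V_{k^d+1,p}(\mu) \le C\int_X \left(1+d(x,x_0)^{p+\delta}+f(d(x,x_0))^p\right) d\mu(x)\quad\text{for all } k\in\mathbb{N},\ k\ge 1.$$ Consequently, $$\limsup_{N\to\infty} N^{p/d}\, V_{N,p}(\mu) \le C\int_X \left(1+d(x,x_0)^{p+\delta}+f(d(x,x_0))^p\right) d\mu(x).$$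
   Context: A geodesic space is a metric space in which any two points are joined by a length-minimizing geodesic whose length equals their distance. $B_r(x)$ is the open ball of radius $r$ centered at $x$, and $\partial B_R(x_0)$ is its boundary, the sphere of radius $R$ (in a geodesic space and for $R>0$ this is $\{x : d(x,x_0)=R\}$). For $A\subseteq X$ and a real number $t\geq 0$, the covering radius $r_t(A)\in[0,\infty]$ is the infimum of all $r>0$ such that $A$ can be covered by at most $t$ open balls of radius $r$ with centers in $X$ (infimum of the empty set $=\infty$). For $t=N\in\mathbb{N}$ this is the $N$th covering radius of $A$. For a finite Borel measure $\mu$ on $X$ and real $t\ge 1$, the quantization error is $V_{t,p}(\mu)=\inf_{S}\int_X d(x,S)^p\,d\mu(x)$, the infimum being over nonempty finite subsets $S\subseteq X$ with cardinality at most $t$, where $d(x,S)=\inf_{y\in S}d(x,y)$. The integral on the right-hand side is allowed to be $+\infty$. *)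

(* Defs.v *)
From HB Require Import structures.
From mathcomp Require Import all_boot all_order all_algebra finmap.
From mathcomp Require Import all_classical all_reals all_analysis.

Set Implicit Arguments.
Unset Strict Implicit.
Unset Printing Implicit Defensive.

Import Order.TTheory GRing.Theory Num.Theory.
Import numFieldNormedType.Exports.

Local Open Scope classical_set_scope.
Local Open Scope ring_scope.

(* The base point that comes with Complete is arbitrary: it only records that
   the space is nonempty. *)
#[short(type="completeMetricType")]
HB.structure Definition CompleteMetric (R : numDomainType) :=
  { T of Metric R T & Complete T }.

Definition borel (T : topologicalType) := g_sigma_algebraType (@open T).

Definition boundary (T : topologicalType) (A : set T) : set T :=
  closure A `\` interior A.

(* As in variation, s lists the points of a partition of [a, b] other than a. *)
Definition curve_variation (R : realType) (X : metricType R) (a b : R)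
    (g : R -> X) (s : seq R) : R :=
  \sum_(0 <= i < size s)
    mdist (g (nth b (a :: s) i)) (g (nth b (a :: s) i.+1)).

Definition curve_length (R : realType) (X : metricType R) (a b : R)
    (g : R -> X) : \bar R :=
  ereal_sup [set (curve_variation a b g s)%:E | s in itv_partition a b].

(* As the length of a curve is at least the distance of its endpoints, such
   a curve is automatically length-minimizing. *)
Definition geodesic_space (R : realType) (X : metricType R) : Prop :=
  forall x y : X, exists g : R -> X,
    [/\ {within `[0, 1], continuous g}, g 0 = x, g 1 = y
      & curve_length 0 1 g = (mdist x y)%:E].

Definition covering_radius (R : realType) (X : metricType R) (t : R)
    (A : set X) : \bar R :=
  ereal_inf [set r%:E | r in [set r : R | 0 < r /\
    exists S : {fset X}, (#|` S|%fset)%:R <= t /\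
      A `<=` \bigcup_(y in [set` S]) ball y r]].

(* For k = 0 the inequality reads 0 <= f r, since 0 * +oo = 0 in \bar R: the
   value given to 0 `^ (d - 1) does not matter. *)
Definition has_covering_growth (R : realType) (X : metricType R) (f : R -> R)
    (d : R) (x0 : X) : Prop :=
  forall (k : nat) (r : R), 0 < r ->
    (k%:R%:E * covering_radius (k%:R `^ (d - 1)) (boundary (ball x0 r))
      <= (f r)%:E)%E.

Definition dist_to (R : realType) (X : metricType R) (S : {fset X}) (x : X) : R :=
  inf [set mdist x y | y in [set` S]].

Definition quantization_error (R : realType) (X : completeMetricType R)
    (t p : R) (mu : set (borel X) -> \bar R) : \bar R :=
  ereal_inf [set (\int[mu]_x ((dist_to S x) `^ p)%:E)%E
    | S in [set S : {fset X} | S != fset0 /\ (#|` S|%fset)%:R <= t]].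

(* Main.v *)
Require Import Defs.
From HB Require Import structures.
From mathcomp Require Import all_boot all_order all_algebra finmap.
From mathcomp Require Import all_classical all_reals all_analysis.
From mathcomp Require Import measurable_realfun ring lra.

Set Implicit Arguments.
Unset Strict Implicit.
Unset Printing Implicit Defensive.

Import Order.TTheory GRing.Theory Num.Theory.
Import numFieldNormedType.Exports.

Local Open Scope classical_set_scope.
Local Open Scope ring_scope.

(**
The space is discretized radially first and spherically second.

Fix [k >= 1], put [e = delta / p], write [|x|] for the distance of [x] to [x0],
and replace this distance by the decreasing coordinate
[u(x) = (1 + |x|) `^ (- e)], which takes its values between [0] and [1].  Cut
this interval into [k] equal pieces.  The positive cut points are the values of
[u] on [k] spheres around [x0], the innermost of which has radius [0] and is
just [x0].  A step [1 / k] of [u] that ends at [x] is a radial step of at most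
[(1 + |x|) `^ (1 + e) / (e k)], by convexity of [b |-> b `^ (- e)]
([radial_gap]).  This holds even on the unbounded outermost piece: there the
moment of order [p + delta], which is larger than [p], pays for the step.

Cover each of the other [k - 1] spheres by at most [k `^ (d - 1)] balls, which
by the growth hypothesis can be given radius [(f R + 1) / k]
([covering_growth_cover]).  The centers together with [x0] form a set [S] of at
most [(k - 1) k `^ (d - 1) + 1 <= k `^ d + 1] points.  To bound the distance
from [x] to [S], slide [x] along a geodesic towards [x0] down to the next
sphere of the family ([geodesic_point], [sphere_sub_boundary]) and jump to the
nearest center.  Sliding inwards rather than outwards matters: as [f] is
nondecreasing, [f R <= f |x|].  This gives ([exists_net])
[k * dist_to S x <= (1 + |x|) `^ (1 + e) / e + f |x| + 1].
Since [p * (1 + e) = p + delta], the [p]-th power of the right-hand side is at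
most a constant times [1 + |x| `^ (p + delta) + (f |x|) `^ p]
([powR_sum_bound]), and integrating proves the first inequality.

For the upper limit, any [N >= 2] lies between [k `^ d + 1] and
[2 (2 k) `^ d] for some [k >= 1] ([nat_powR_bracket]); as the quantization error
is nonincreasing in the number of points, the bound for [k] is one for [N] after
multiplying the constant by [2 `^ (p / d) * 2 `^ p].
*)

(** * Distance functions *)

Section Lipschitz.
Variables (R : realType) (X : metricType R).
Implicit Types (h : X -> R) (x y : X).

Lemma lipschitz1_continuous h :
  (forall x y, h x <= h y + mdist x y) -> continuous h.
Proof.
move=> hL x; apply/cvgrPdist_lt => e e0.
apply/(@metricType_numDomainType.nbhs_mdistP _ X); exists e => //= y xy.
rewrite ltr_norml; have := hL x y; have := hL y x.
by move: xy => /= xy; rewrite (metric_sym y x) => h1 h2; apply/andP; split; lra.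
Qed.

Lemma mdist_lipschitz1 (z x y : X) : mdist z x <= mdist z y + mdist x y.
Proof. by rewrite (metric_sym x y) metric_triangle. Qed.

Lemma dist_to_le (S : {fset X}) x y : y \in S -> dist_to S x <= mdist x y.
Proof.
move=> yS; apply: ge_inf; last by exists y.
by exists 0 => _ [z _ <-]; exact: mdist_ge0.
Qed.

Lemma dist_to_ge (S : {fset X}) x c : S != fset0 ->
  (forall y, y \in S -> c <= mdist x y) -> c <= dist_to S x.
Proof.
move=> /fset0Pn[z zS] cS; apply: lb_le_inf; first by exists (mdist x z), z.
by move=> _ [y yS <-]; exact: cS.
Qed.

Lemma dist_to_lipschitz1 (S : {fset X}) x y : S != fset0 ->
  dist_to S x <= dist_to S y + mdist x y.
Proof.
move=> S0; rewrite -lerBlDr; apply: dist_to_ge => // z zS.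
rewrite lerBlDr (le_trans (dist_to_le _ zS))// addrC.
exact: metric_triangle.
Qed.

End Lipschitz.

Section BorelMeasurability.
Variables (R : realType) (X : completeMetricType R).

Lemma continuous_borel_measurable (h : X -> R) :
  continuous h -> measurable_fun [set: borel X] h.
Proof.
move=> /continuousP ch.
apply: (measurability _ (RGenOpens.measurableE R)) => //.
move=> _ [_ [a [b ->] <-]]; rewrite setTI.
by apply: sub_sigma_algebra; apply: ch; exact: interval_open.
Qed.

Lemma lipschitz1_borel_measurable (h : X -> R) :
  (forall x y, h x <= h y + mdist x y) -> measurable_fun [set: borel X] h.
Proof. by move=> /lipschitz1_continuous/continuous_borel_measurable. Qed.

End BorelMeasurability.

(** * Geodesics and spheres *)

Section Geodesics.
Variables (R : realType) (X : metricType R).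
Hypothesis geoX : geodesic_space X.

(** The intermediate value theorem gives a point of a geodesic at the prescribed
    distance from its origin; the variation of the geodesic over the partition
    of [[0, 1]] that this point defines is at most its length, which forces
    equality in the triangle inequality. *)
Lemma geodesic_point (x0 x : X) (r : R) : 0 <= r <= mdist x0 x ->
  exists2 y, mdist x0 y = r & mdist y x = mdist x0 x - r.
Proof.
move=> /andP[r0 rx].
have [->|rN0] := eqVneq r 0; first by exists x0; rewrite ?mdistxx ?subr0.
have [->|rNx] := eqVneq r (mdist x0 x);
  first by exists x; rewrite ?mdistxx ?subrr.
have [g [cg g0 g1 lg]] := geoX x0 x.
have cdg : {within `[0, 1], continuous (fun t : R => mdist x0 (g t))}.
  move=> t; apply: continuous_comp (cg t) _.
  by apply: lipschitz1_continuous => u v; exact: mdist_lipschitz1.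
have [||t] := @IVT _ _ 0 1 r _ cdg.
- exact: ler01.
- by rewrite g0 g1 mdistxx ge_min r0/= le_max rx orbT.
rewrite in_itv/= => /andP[t0 t1] gt; exists (g t) => //.
have {}t0 : 0 < t.
  rewrite lt_neqAle t0 andbT; apply: contraNneq rN0 => t0'.
  by rewrite -gt -t0' g0 mdistxx.
have {}t1 : t < 1.
  rewrite lt_neqAle t1 andbT; apply: contraNneq rNx => t1'.
  by rewrite -gt t1' g1.
have : ((curve_variation 0 1 g [:: t; 1])%:E <= curve_length 0 1 g)%E.
  apply: ereal_sup_ubound; exists [:: t; 1] => //.
  by split => //=; rewrite t0 t1.
rewrite lg lee_fin /curve_variation/= big_mkord !big_ord_recl big_ord0/= addr0.
rewrite g0 g1 gt => le_x; apply/eqP; rewrite eq_le.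
by have := metric_triangle x0 (g t) x; rewrite gt => ge_x; lra.
Qed.

(** The growth hypothesis is about topological boundaries, whereas geodesics
    yield points at a given distance.  Points of the geodesic slightly closer
    to [x0] show that a point of the sphere is in the closure of the open
    ball. *)
Lemma sphere_sub_boundary (x0 y : X) : 0 < mdist x0 y ->
  boundary (ball x0 (mdist x0 y)) y.
Proof.
move=> y0; split; last first.
  by move=> /interior_subset; rewrite ballEmdist/= ltxx.
move=> B /(@metricType_numDomainType.nbhs_mdistP _ X)[e /= e0 eB].
pose s := Num.min (mdist x0 y) (e / 2).
have s0 : 0 < s by rewrite lt_min y0 divr_gt0.
have [|z zr zy] := @geodesic_point x0 y (mdist x0 y - s).
  by rewrite subr_ge0 ge_min lexx/= lerBlDr lerDl ltW.
exists z; split; first by rewrite ballEmdist/= zr ltrBlDr ltrDl.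
apply: eB; rewrite /= metric_sym zy opprB addrC subrK.
by rewrite gt_min; apply/orP; right; lra.
Qed.

End Geodesics.

(** * Covering spheres by few balls *)

Section Coverings.
Variables (R : realType) (X : metricType R).

Lemma covering_radius_lt (t r : R) (A : set X) :
  (covering_radius t A < r%:E)%E ->
  exists2 S : {fset X}, (#|` S|%fset)%:R <= t &
    forall x, A x -> exists2 y, y \in S & mdist y x < r.
Proof.
move=> /ereal_inf_lt[_ [s [s0 [S [St AS]]] <-]]; rewrite lte_fin => sr.
exists S => // x /AS[y /= yS]; rewrite ballEmdist/= => ys.
by exists y => //; exact: lt_trans sr.
Qed.

(** The infimum defining the covering radius may fail to be attained: the [+ 1]
    makes the radius strictly larger than [f r / k]. *)
Lemma covering_growth_cover (f : R -> R) (d : R) (x0 : X) (k : nat) (r : R) :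
  has_covering_growth f d x0 -> (0 < k)%N -> 0 < r ->
  exists2 S : {fset X}, (#|` S|%fset)%:R <= k%:R `^ (d - 1) &
    forall x, boundary (ball x0 r) x ->
      exists2 y, y \in S & mdist y x < (f r + 1) / k%:R.
Proof.
move=> growth k0 r0; apply: covering_radius_lt.
have := growth k r r0; rewrite -lee_pdivlMl ?ltr0n// => /le_lt_trans; apply.
by rewrite -EFinM lte_fin mulrC ltr_pM2r ?invr_gt0 ?ltr0n// ltrDl.
Qed.

Lemma fset_union_upward_closed (T : choiceType) (P : nat -> {fset T} -> Prop)
    (c : R) n :
  (forall i A B, (A `<=` B)%fset -> P i A -> P i B) ->
  (forall i, (i < n)%N -> exists2 A, (#|` A|%fset)%:R <= c & P i A) ->
  exists2 B : {fset T}, (#|` B|%fset)%:R <= n%:R * c &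
    forall i, (i < n)%N -> P i B.
Proof.
move=> Pup; elim: n => [|n ih] Pn.
  by exists fset0; rewrite ?cardfs0 ?mul0r.
have [|B Bc PB] := ih; first by move=> i ilt; apply: Pn; exact: ltnW.
have [A Ac PA] := Pn n (ltnSn n).
exists (A `|` B)%fset.
  have : ((#|` A `|` B|%fset)%:R : R) <= (#|` A|%fset)%:R + (#|` B|%fset)%:R.
    by rewrite -natrD ler_nat (leq_card_fsetU A B).1.
  by rewrite -natr1 mulrDl mul1r; lra.
move=> i; rewrite ltnS leq_eqVlt => /predU1P[->|ilt].
  by apply: Pup PA; exact: fsubsetUl.
by apply: Pup (PB _ ilt); exact: fsubsetUr.
Qed.

End Coverings.

(** * Radial discretization and the net *)

(** The graph of [t |-> t `^ (- e)] lies above its tangent at [t = b].  By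
    homogeneity this reduces to [(a / b) `^ (- e) >= 1 + e (1 - a / b)], which
    follows from [expR y >= 1 + y] and [ln y <= y - 1]. *)
Lemma radial_gap (R : realType) (e a b : R) : 0 <= e -> 0 < a -> 0 < b ->
  e * (b - a) <= b `^ (1 + e) * (a `^ (- e) - b `^ (- e)).
Proof.
move=> e0 a0 b0; have ab : 0 < a / b by rewrite divr_gt0.
have -> : b `^ (1 + e) * (a `^ (- e) - b `^ (- e)) = b * ((a / b) `^ (- e) - 1).
  have <- : (a / b) `^ (- e) * b `^ (- e) = a `^ (- e).
    by rewrite -powRM ?(ltW ab) ?(ltW b0)// divfK// gt_eqF.
  rewrite powRD ?(gt_eqF b0) ?implybT// (powRr1 (ltW b0)) (powRN b).
  by field; rewrite gt_eqF// powR_gt0.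
have -> : e * (b - a) = b * (e * (1 - a / b)) by field; rewrite gt_eqF.
rewrite ler_pM2l// /powR gt_eqF//.
have := expR_ge1Dx (- e * ln (a / b)).
have : ln (1 + (a / b - 1)) <= a / b - 1.
  by apply: le_ln1Dx; lra.
rewrite addrC subrK; nra.
Qed.

(** For [i < k - 1] the sphere of index [i] is the one on which
    [(1 + |y|) `^ (- e) = (i + 1) / k]; the index [i = k - 1] would give the
    point [x0].  A point [x] slides to the sphere whose index is the integer
    part of [k (1 + |x|) `^ (- e)], or to [x0] if that integer is at least
    [k - 1]. *)
Lemma exists_net (R : realType) (X : metricType R) (x0 : X) (d e : R)
    (f : R -> R) (k : nat) :
  geodesic_space X -> 0 < d -> 0 < e ->
  (forall r : R, 0 <= r -> 0 <= f r) ->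
  (forall r s : R, 0 <= r -> r <= s -> f r <= f s) ->
  has_covering_growth f d x0 -> (0 < k)%N ->
  exists S : {fset X}, [/\ S != fset0, (#|` S|%fset)%:R <= k%:R `^ d + 1 &
    forall x, k%:R * dist_to S x <=
      (1 + mdist x x0) `^ (1 + e) / e + f (mdist x x0) + 1].
Proof.
move=> geoX d0 e0 f0 f_nd growth k0; have kR0 : 0 < k%:R :> R by rewrite ltr0n.
pose radius (i : nat) : R := (i.+1%:R / k%:R) `^ (- e^-1) - 1.
have radius_gt0 i : (i < k.-1)%N -> 0 < radius i.
  move=> ik; have i1k : (i.+1 < k)%N by rewrite -[k]prednK// ltnS.
  have q0 : 0 < i.+1%:R / k%:R :> R by rewrite divr_gt0 ?ltr0n.
  have q1 : i.+1%:R / k%:R < 1 :> R by rewrite ltr_pdivrMr// mul1r ltr_nat.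
  rewrite subr_gt0 powRN invf_gt1 ?powR_gt0//.
  have : (i.+1%:R / k%:R) `^ e^-1 < 1 `^ e^-1 :> R.
    by apply: gt0_ltr_powR; rewrite ?nnegrE ?invr_gt0// ltW.
  by rewrite powR1.
pose covers i (S : {fset X}) := forall x, boundary (ball x0 (radius i)) x ->
  exists2 y, y \in S & mdist y x < (f (radius i) + 1) / k%:R.
have [||S Scard Scov] :=
  @fset_union_upward_closed R X covers (k%:R `^ (d - 1)) k.-1.
- move=> i A B /fsubsetP AB Acov x /Acov[y yA yx]; exists y => //; exact: AB.
- by move=> i /radius_gt0; exact: covering_growth_cover.
exists (x0 |` S)%fset; split.
- by apply/fset0Pn; exists x0; rewrite in_fset1U eqxx.
- have kd : k%:R * k%:R `^ (d - 1) = k%:R `^ d by rewrite mulr_powRB1 ?ltW.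
  have : ((#|` x0 |` S|%fset)%:R : R) <= 1 + (#|` S|%fset)%:R.
    by rewrite cardfsU1 natrD lerD2r lern1 leq_b1.
  have : k.-1%:R * k%:R `^ (d - 1) <= k%:R * k%:R `^ (d - 1) :> R.
    by rewrite ler_wpM2r ?powR_ge0// ler_nat leq_pred.
  by rewrite kd; lra.
move=> x; rewrite (metric_sym x x0).
set t := mdist x0 x; set b := 1 + t.
have t0 : 0 <= t by exact: mdist_ge0.
have b0 : 0 < b by rewrite /b; lra.
have dS z y : z \in (x0 |` S)%fset -> mdist x z <= y ->
    k%:R * dist_to (x0 |` S)%fset x <= k%:R * y.
  by move=> zS xz; rewrite ler_pM2l// (le_trans (dist_to_le _ zS)).
have ft := f0 t t0.
pose u := k%:R * b `^ (- e).
have u0 : 0 <= u by rewrite mulr_ge0 ?powR_ge0 ?ltW.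
have /andP[iu ui] := truncn_itv u0; set i := Num.trunc u in iu ui.
(* The slide from x down to radius a - 1 is short as soon as the coordinate u
   grows by at most 1 / k along it. *)
have gap a : 0 < a -> k%:R * a `^ (- e) <= i.+1%:R ->
    k%:R * (b - a) <= b `^ (1 + e) / e.
  move=> a0 ai; have := radial_gap (ltW e0) a0 b0.
  rewrite ler_pdivlMr//.
  have : k%:R * (a `^ (- e) - b `^ (- e)) <= 1.
    by rewrite mulrBr -/u; rewrite -natr1 in ai; lra.
  have : 0 <= b `^ (1 + e) by exact: powR_ge0.
  move: (b `^ (1 + e)) (a `^ (- e) - b `^ (- e)) => B w B0 kw1 eBw.
  have : k%:R * (e * (b - a)) <= k%:R * (B * w) by rewrite ler_pM2l.
  have : B * (k%:R * w) <= B * 1 by rewrite ler_wpM2l.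
  by lra.
have [ik|ki] := ltnP i k.-1; last first.
  have := dS x0 t; rewrite in_fset1U eqxx (metric_sym x x0).
  move=> /(_ isT (lexx _)).
  have : k%:R * (b - 1) <= b `^ (1 + e) / e.
    by apply: gap; rewrite // powR1 mulr1 ler_nat -[k]prednK// ltnS.
  by rewrite /b; lra.
set a := (i.+1%:R / k%:R : R) `^ (- e^-1).
have ra : radius i = a - 1 by [].
have q0 : 0 < i.+1%:R / k%:R :> R by rewrite divr_gt0 ?ltr0n.
have a0 : 0 < a by rewrite powR_gt0.
have aE : a `^ (- e) = i.+1%:R / k%:R.
  by rewrite /a -powRrM mulrNN mulVf ?gt_eqF// powRr1// ltW.
have ab : a <= b.
  rewrite leNgt; apply/negP => ba.
  have : b `^ e < a `^ e by apply: gt0_ltr_powR; rewrite ?nnegrE ?ltW.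
  rewrite -ltf_pV2 ?posrE ?powR_gt0// -!powRN aE ltr_pdivrMr// mulrC -/u.
  by rewrite ltNge (ltW ui).
have r0 := radius_gt0 i ik.
have [|y yr yx] := @geodesic_point R X geoX x0 x (radius i).
  by rewrite (ltW r0) ra lerBlDl.
have [|z zS zy] := Scov i ik y.
  by rewrite -yr; apply: sphere_sub_boundary => //; rewrite yr.
have := dS z (mdist x y + mdist y z); rewrite in_fset1U zS orbT => /(_ isT).
rewrite metric_triangle => /(_ isT).
have : f (radius i) <= f t by apply: f_nd; rewrite ?(ltW r0)// ra lerBlDl.
have := gap a a0; rewrite aE mulrC divfK ?gt_eqF// lexx => /(_ isT).
move: zy; rewrite ltr_pdivlMr// (metric_sym x y) yx (metric_sym z y) ra -/t.
by rewrite /b; lra.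
Qed.

(** * Powers and integrals *)

(** All three summands are at most a constant times the maximum [M] of [1],
    [r `^ (1 + e)] and [v], and [M `^ p] is one of the three terms on the
    right. *)
Lemma powR_sum_bound (R : realType) (p q e : R) : 0 < p -> 0 < e ->
  q = p * (1 + e) ->
  exists2 C : R, 0 < C & forall r v : R, 0 <= r -> 0 <= v ->
    ((1 + r) `^ (1 + e) / e + v + 1) `^ p <= C * (1 + r `^ q + v `^ p).
Proof.
move=> p0 e0 qE; pose L := 2 `^ (1 + e) / e + 2 : R.
have L0 : 0 < L by rewrite ltr_wpDl// divr_ge0 ?powR_ge0 ?ltW.
exists (L `^ p); first exact: powR_gt0.
move=> r v r0 v0.
pose M := Num.max 1 (Num.max (r `^ (1 + e)) v).
have M1 : 1 <= M by rewrite le_max lexx.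
have Mr : r `^ (1 + e) <= M by rewrite !le_max lexx !orbT.
have Mv : v <= M by rewrite !le_max lexx !orbT.
have M0 : 0 <= M by lra.
have br : (1 + r) `^ (1 + e) <= 2 `^ (1 + e) * M.
  have [r1|r1] := leP r 1.
    apply: (@le_trans _ _ (2 `^ (1 + e) * 1)).
      by rewrite mulr1; apply: ge0_ler_powR; rewrite ?nnegrE; lra.
    by rewrite ler_wpM2l// powR_ge0.
  apply: (@le_trans _ _ (2 `^ (1 + e) * r `^ (1 + e))).
    by rewrite -powRM//; apply: ge0_ler_powR; rewrite ?nnegrE; lra.
  by rewrite ler_wpM2l// powR_ge0.
have sumM : (1 + r) `^ (1 + e) / e + v + 1 <= L * M.
  have : (1 + r) `^ (1 + e) / e <= 2 `^ (1 + e) / e * M.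
    by rewrite mulrAC ler_pM2r// invr_gt0.
  by rewrite /L; lra.
apply: (@le_trans _ _ ((L * M) `^ p)).
  apply: ge0_ler_powR; rewrite ?nnegrE ?(ltW p0) ?mulr_ge0 ?(ltW L0)//.
  have : 0 <= (1 + r) `^ (1 + e) / e by rewrite divr_ge0 ?powR_ge0 ?(ltW e0).
  by lra.
rewrite powRM ?(ltW L0)// ler_pM2l ?powR_gt0//.
have rq : (r `^ (1 + e)) `^ p = r `^ q by rewrite -powRrM mulrC qE.
have rq0 := powR_ge0 r q; have vp0 := powR_ge0 v p; rewrite /M.
by case: (leP (r `^ (1 + e)) v) => _; case: (leP 1) => _;
  rewrite ?rq ?powR1 /=; lra.
Qed.

Section Quantization.
Variables (R : realType) (X : completeMetricType R).
Implicit Type mu : {measure set (borel X) -> \bar R}.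

Lemma quantization_error_ge0 (t p : R) mu :
  (0 <= quantization_error t p mu)%E.
Proof.
apply: le_ereal_inf_tmp => _ [S _ <-]; apply: integral_ge0 => x _.
by rewrite lee_fin powR_ge0.
Qed.

Lemma quantization_error_le (s t p : R) mu :
  s <= t -> (quantization_error t p mu <= quantization_error s p mu)%E.
Proof.
move=> st; apply: le_ereal_inf => _ [S [S0 Ss] <-]; exists S => //.
by split => //; exact: le_trans st.
Qed.

Lemma quantization_error_net (t p k : R) mu
    (S : {fset X}) (g : X -> R) :
  0 <= p -> 0 <= k -> S != fset0 -> (#|` S|%fset)%:R <= t ->
  measurable_fun [set: borel X] g ->
  (forall x, (k * dist_to S x) `^ p <= g x) ->
  ((k `^ p)%:E * quantization_error t p mu <= \int[mu]_x (g x)%:E)%E.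
Proof.
move=> p0 k0 S0 St mg Sg.
have dist_ge0 x : 0 <= dist_to S x.
  by apply: dist_to_ge => // y _; exact: mdist_ge0.
have mS : measurable_fun [set: borel X] (fun x => dist_to S x `^ p).
  apply: (measurableT_comp (@measurable_powR R p)).
  by apply: lipschitz1_borel_measurable => x y; exact: dist_to_lipschitz1.
apply: (@le_trans _ _ ((k `^ p)%:E * \int[mu]_x (dist_to S x `^ p)%:E)%E).
  apply: lee_wpmul2l; first by rewrite lee_fin powR_ge0.
  by apply: ereal_inf_lbound; exists S.
rewrite -ge0_integralZl_EFin ?powR_ge0//; last first.
- exact/measurable_EFinP.
- by move=> x _; rewrite lee_fin powR_ge0.
apply: ge0_le_integral => //.
- by move=> x _; rewrite -EFinM lee_fin mulr_ge0 ?powR_ge0.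
- by apply: measurable_funeM; exact/measurable_EFinP.
- exact/measurable_EFinP.
- by move=> x _; rewrite -EFinM lee_fin -powRM.
Qed.

End Quantization.

(** * Passage to the upper limit *)

Lemma limn_esup_le_bound (R : realType) (u : (\bar R)^nat) (l : \bar R)
    (n0 : nat) :
  (forall n, (n0 <= n)%N -> (u n <= l)%E) -> (limn_esup u <= l)%E.
Proof.
move=> ul; apply: (@le_trans _ _ (ereal_sup (u @` [set n | (n0 <= n)%N]))).
  by apply: ereal_inf_lbound; exists [set n | (n0 <= n)%N] => //; exists n0.
by apply: ge_ereal_sup => _ [n /= n0n <-]; exact: ul.
Qed.

(** Take for [k] the integer part of [(N - 1) `^ d^-1] and use
    [k + 1 <= 2 k]. *)
Lemma nat_powR_bracket (R : realType) (d : R) (N : nat) : 0 < d -> (2 <= N)%N ->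
  exists2 k : nat, (0 < k)%N &
    k%:R `^ d + 1 <= N%:R /\ N%:R <= 2 * (2 * k%:R) `^ d :> R.
Proof.
move=> d0 N2; have N2R : 2 <= N%:R :> R by rewrite ler_nat.
pose y : R := N%:R - 1; have y1 : 1 <= y by rewrite /y; lra.
have yd : (y `^ d^-1) `^ d = y.
  by rewrite -powRrM mulVf ?gt_eqF// powRr1//; lra.
have root1 : 1 <= y `^ d^-1.
  have : 1 `^ d^-1 <= y `^ d^-1.
    by apply: ge0_ler_powR; rewrite ?nnegrE ?invr_ge0 ?(ltW d0)//; lra.
  by rewrite powR1.
have /andP[ky yk] := truncn_itv (le_trans ler01 root1).
set k := Num.trunc _ in ky yk.
have k0 : (0 < k)%N.
  by rewrite lt0n; apply/eqP => kE; move: yk; rewrite kE; lra.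
have k1 : 1 <= k%:R :> R by rewrite ler1n.
exists k => //; split.
  have : k%:R `^ d <= (y `^ d^-1) `^ d.
    by apply: ge0_ler_powR; rewrite ?nnegrE ?(ltW d0)//; lra.
  by rewrite yd /y; lra.
have : (y `^ d^-1) `^ d <= (2 * k%:R) `^ d.
  rewrite -natr1 in yk.
  by apply: ge0_ler_powR; rewrite ?nnegrE ?(ltW d0)//; lra.
by rewrite yd /y; lra.
Qed.

Theorem theorem1p6 (R : realType) (X : completeMetricType R) (x0 : X)
    (d : R) (f : R -> R) (p delta : R) :
  geodesic_space X ->
  0 < d ->
  (forall r : R, 0 <= r -> 0 <= f r) ->
  (forall r s : R, 0 <= r -> r <= s -> f r <= f s) ->
  has_covering_growth f d x0 ->
  1 <= p ->
  0 < delta ->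
  exists C : R, 0 < C /\
    forall mu : {finite_measure set (borel X) -> \bar R},
      (\int[mu]_x ((mdist (x : X) x0) `^ (p + delta))%:E < +oo)%E ->
      (forall k : nat, (1 <= k)%N ->
        ((k%:R `^ p)%:E * quantization_error (k%:R `^ d + 1) p mu
         <= C%:E * \int[mu]_x (1 + (mdist (x : X) x0) `^ (p + delta)
                               + (f (mdist (x : X) x0)) `^ p)%:E)%E) /\
      (limn_esup (fun N : nat =>
          (N%:R `^ (p / d))%:E * quantization_error N%:R p mu)
       <= C%:E * \int[mu]_x (1 + (mdist (x : X) x0) `^ (p + delta)
                             + (f (mdist (x : X) x0)) `^ p)%:E)%E.
Proof.
move=> geoX d0 f0 f_nd growth p1 delta0; have p0 : 0 < p by lra.
pose e := delta / p; have e0 : 0 < e by rewrite divr_gt0.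
have qE : p + delta = p * (1 + e) by rewrite /e; field; rewrite gt_eqF.
have [C1 C10 powC1] := powR_sum_bound p0 e0 qE.
pose D : R := 2 `^ (p / d) * 2 `^ p.
have D1 : 1 <= D.
  have two_powR_ge1 s : 0 <= s -> 1 <= 2 `^ s :> R.
    by move=> s0; rewrite -[leLHS](powRr0 2); apply: ler_powR; rewrite ?ler1n.
  by rewrite -[leLHS]mulr1 ler_pM// two_powR_ge1// ?divr_ge0 ?ltW.
exists (C1 * D); split; first by rewrite mulr_gt0//; lra.
move=> mu _; set I := (\int[mu]_x _)%E.
have I0 : (0 <= I)%E.
  by apply: integral_ge0 => x _; rewrite lee_fin !addr_ge0 ?powR_ge0.
have mabs : measurable_fun [set: borel X] (fun x : X => mdist x x0).
  apply: lipschitz1_borel_measurable => x y.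
  by rewrite addrC; exact: metric_triangle.
(* f is monotone on nonnegative reals only, so it is first made constant on the
   negative ones. *)
have mf : measurable_fun [set: borel X] (fun x : X => f (mdist x x0)).
  rewrite (_ : (fun x => _) =
      (fun r => f (Num.max 0 r)) \o (fun x : X => mdist x x0)).
    apply: measurableT_comp mabs; apply: nondecreasing_measurable => // r s rs.
    apply: f_nd; first by rewrite le_max lexx.
    by rewrite ge_max le_max lexx/= le_max rs orbT.
  by apply/funext => x /=; rewrite max_r ?mdist_ge0.
pose h (x : X) := 1 + mdist x x0 `^ (p + delta) + f (mdist x x0) `^ p.
have mh : measurable_fun [set: borel X] h.
  apply: measurable_funD; first apply: measurable_funD => //.
    exact: (measurableT_comp (@measurable_powR R _)).
  exact: (measurableT_comp (@measurable_powR R _)).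
have bound k : (0 < k)%N ->
    ((k%:R `^ p)%:E * quantization_error (k%:R `^ d + 1) p mu <= C1%:E * I)%E.
  move=> k0.
  have [S [S0 Sk Sx]] := exists_net geoX d0 e0 f0 f_nd growth k0.
  rewrite /I -ge0_integralZl_EFin ?(ltW C10)//; last first.
  - exact/measurable_EFinP.
  - by move=> x _; rewrite lee_fin !addr_ge0 ?powR_ge0.
  under eq_integral do rewrite -EFinM.
  apply: (@quantization_error_net _ _ _ _ _ _ S (fun x => C1 * h x)) => //;
    rewrite ?(ltW p0)//.
    exact: measurable_funM.
  have x_ge0 x := mdist_ge0 x x0.
  move=> x; apply: le_trans (powC1 _ _ (x_ge0 x) (f0 _ (x_ge0 x))).
  have dS0 : 0 <= k%:R * dist_to S x.
    by rewrite mulr_ge0// (dist_to_ge S0)// => y _; exact: mdist_ge0.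
  apply: ge0_ler_powR; rewrite ?nnegrE ?(ltW p0)//.
  exact: le_trans dS0 (Sx x).
split=> [k k0|].
  apply: le_trans (bound k k0) _; rewrite lee_wpmul2r// lee_fin.
  by rewrite ler_peMr// (ltW C10).
apply: (@limn_esup_le_bound _ _ _ 2) => N N2.
have [k k0 [kN Nk]] := nat_powR_bracket d0 N2.
have ND : N%:R `^ (p / d) <= D * k%:R `^ p.
  rewrite /D -mulrA -powRM//.
  have -> : (2 * k%:R : R) `^ p = ((2 * k%:R) `^ d) `^ (p / d).
    by rewrite -powRrM [d * _]mulrC divfK ?gt_eqF.
  rewrite -powRM ?powR_ge0//.
  by apply: ge0_ler_powR;
    rewrite ?nnegrE ?divr_ge0 ?(ltW p0) ?(ltW d0) ?mulr_ge0 ?powR_ge0.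
have V0 := quantization_error_ge0 (k%:R `^ d + 1) p mu.
apply: (@le_trans _ _
  ((D * k%:R `^ p)%:E * quantization_error (k%:R `^ d + 1) p mu)%E).
  apply: lee_pmul => //; rewrite ?lee_fin ?powR_ge0 ?quantization_error_ge0//.
  exact: quantization_error_le.
rewrite [C1 * D]mulrC !(EFinM D) -!muleA.
by apply: lee_wpmul2l (bound k k0); rewrite lee_fin; lra.
Qed.
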